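(* Let $\Delta t>0$ and let the deviations satisfy $$\eta_{k+1} = \eta_k + \Delta t\, \nabla p(w_k)\eta_k + \Delta t\, \xi_{\text{MC}}(w_k+\eta_k).$$ For any $\zeta\in(0,1)$, if the conditions $$\mathbb{E}_k\big[\|[I+\Delta t\,\nabla p(w_k)]\eta_k\|\big] < \zeta \qquad\text{and}\qquad \Delta t < \frac{1-\zeta}{\mathbb{E}_k[\|\xi_{\text{MC}}(w_k+\eta_k)\|]}$$ are met, then the iterative update at iteration $k+1$ is linearly stable, i.e. $\mathbb{E}_k[\|\eta_{k+1}\|]<1$.
   Context: $p:\mathbb{R}^d\to\mathbb{R}^d$ is a differentiable search direction with Jacobian $\nabla p$. The explicit Euler iteration is $w_{k+1}=w_k+\Delta t\,p(w_k)$, with step length $\Delta t>0$. $p_{\text{MC}}$ is a random (Monte Carlo subsampled) approximation of $p$, computed at iteration $k$ using random data batches $X_k,S_k$, and $\xi_{\text{MC}}(w)=p_{\text{MC}}(w)-p(w)$ is its error. $\eta_k\in\mathbb{R}^d$ is the (random) deviation from the discretized minimizing flow at iteration $k$, propagated by the linearized recursion in the claim. $\mathbb{E}_k$ denotes the conditional expectation with respect to the batches $X_k,S_k$ at iteration $k$. $\|\cdot\|$ is the $\ell^2$ norm. The discretized flow is called linearly stable if $\mathbb{E}_k[\|\eta_k\|]<1$ can be maintained for all $k$; linear stability of the update at iteration $k+1$ means $\mathbb{E}_k[\|\eta_{k+1}\|]<1$. *)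

(* Defs.v *)
From HB Require Import structures.
From mathcomp Require Import all_boot all_order all_algebra.
From mathcomp Require Import all_classical all_reals all_analysis.
From mathcomp Require Import measurable_realfun.
Import Order.TTheory GRing.Theory Num.Theory numFieldNormedType.Exports.

Set Implicit Arguments.
Unset Strict Implicit.
Unset Printing Implicit Defensive.

Local Open Scope classical_set_scope.
Local Open Scope ring_scope.

(* The norm `|x| that the library puts on 'rV[R]_d is the sup norm; it induces
   the same topology and derivatives, but the inequalities below are about the
   l^2 norm. *)
Definition l2norm (R : rcfType) (d : nat) (x : 'rV[R]_d) : R :=
  Num.sqrt (\sum_(i < d) x 0 i ^+ 2).

(* R^d with its Borel sigma-algebra. *)
Notation borel_rV R d := (g_sigma_algebraType (@open 'rV[R]_d)).

Definition random_vector (disp : measure_display) (T : measurableType disp)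
    (R : realType) (d : nat) (X : T -> 'rV[R]_d) : Prop :=
  measurable_fun [set: T] (X : T -> borel_rV R d).

Definition sub_sigma_algebra_of (disp : measure_display)
    (T : measurableType disp) (G : set (set T)) : Prop :=
  sigma_algebra [set: T] G /\ G `<=` measurable.

(* g is a version of the conditional expectation E[f | G] of a nonnegative f.
   Values are taken in [0, +oo], so that no integrability is required. *)
Definition is_cond_exp (disp : measure_display) (T : measurableType disp)
    (R : realType) (P : probability T R) (G : set (set T))
    (f g : T -> \bar R) : Prop :=
  [/\ measurable_fun [set: g_sigma_algebraType G] g,
      (forall t, (0 <= g t)%E) &
      forall A, G A -> (\int[P]_(t in A) g t = \int[P]_(t in A) f t)%E].

(* The Monte Carlo direction depends on the point and on the two batches used
   to evaluate it; it is jointly measurable in all of them. *)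
Definition measurable_direction (dX dS : measure_display)
    (BX : measurableType dX) (BS : measurableType dS) (R : realType) (d : nat)
    (pMC : 'rV[R]_d -> BX -> BS -> 'rV[R]_d) : Prop :=
  measurable_fun [set: borel_rV R d * (BX * BS)]
    (fun z => pMC z.1 z.2.1 z.2.2 : borel_rV R d).

Definition xiMC (BX BS : Type) (R : realType) (d : nat)
    (p : 'rV[R]_d -> 'rV[R]_d) (pMC : 'rV[R]_d -> BX -> BS -> 'rV[R]_d)
    (w : 'rV[R]_d) (x : BX) (s : BS) : 'rV[R]_d :=
  pMC w x s - p w.

(* Main.v *)
Require Import Defs.
From HB Require Import structures.
From mathcomp Require Import all_boot all_order all_algebra.
From mathcomp Require Import all_classical all_reals all_analysis.
From mathcomp Require Import measurable_realfun.
From mathcomp Require Import ring lra.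
Import Order.TTheory GRing.Theory Num.Theory numFieldNormedType.Exports.

Local Open Scope classical_set_scope.
Local Open Scope ring_scope.

(* The triangle inequality bounds |eta_{k+1}| by
   |[I + dt grad p] eta_k| + dt |xi|, hence, integrating over the events of F k,
   the conditional expectation of |eta_{k+1}| almost surely by
   E_k|[I + dt grad p] eta_k| + dt E_k|xi| < zeta + (1 - zeta) = 1. The noise
   xi is measurable because the recursion expresses it through eta_k and
   eta_{k+1}. *)

Lemma l2norm_ge0 {R : rcfType} {d : nat} (x : 'rV[R]_d) : 0 <= l2norm x.
Proof. exact: sqrtr_ge0. Qed.

Lemma sqr_l2norm {R : rcfType} {d : nat} (x : 'rV[R]_d) :
  l2norm x ^+ 2 = \sum_(i < d) x 0 i ^+ 2.
Proof. by rewrite sqr_sqrtr// sumr_ge0// => i _; rewrite sqr_ge0. Qed.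

Lemma l2norm_eq0 {R : rcfType} {d : nat} (x : 'rV[R]_d) :
  l2norm x = 0 -> x = 0.
Proof.
move=> x0; apply/rowP => i; rewrite mxE; apply/eqP; rewrite -sqrf_eq0.
have /eqP := sqr_l2norm x; rewrite x0 expr0n/= eq_sym psumr_eq0.
  by move=> /allP/(_ i); rewrite mem_index_enum => /(_ isT).
by move=> j _; rewrite sqr_ge0.
Qed.

Lemma l2normZ {R : rcfType} {d : nat} (a : R) (x : 'rV[R]_d) :
  0 <= a -> l2norm (a *: x) = a * l2norm x.
Proof.
move=> a0; rewrite /l2norm.
under eq_bigr do rewrite mxE exprMn.
by rewrite -mulr_sumr sqrtrM ?sqr_ge0// sqrtr_sqr ger0_norm.
Qed.

(** Cauchy-Schwarz is bypassed. With [a], [b] the two norms, each coordinate satisfies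
    [(u + v)^2 <= (a + b) (u^2 / a + v^2 / b)], and these bounds sum to [(a + b)^2]. Zero norms are
    treated first, so that the divisions make sense. *)
Lemma ler_l2normD {R : rcfType} {d : nat} (x y : 'rV[R]_d) :
  l2norm (x + y) <= l2norm x + l2norm y.
Proof.
have [/eqP/l2norm_eq0 ->|x0] := boolP (l2norm x == 0).
  by rewrite add0r lerDr l2norm_ge0.
have [/eqP/l2norm_eq0 ->|y0] := boolP (l2norm y == 0).
  by rewrite addr0 lerDl l2norm_ge0.
have {}x0 : 0 < l2norm x by rewrite lt_def x0 l2norm_ge0.
have {}y0 : 0 < l2norm y by rewrite lt_def y0 l2norm_ge0.
set a := l2norm x in x0 *; set b := l2norm y in y0 *.
rewrite -(@ler_pXn2r _ 2)// ?nnegrE ?l2norm_ge0// ?addr_ge0 ?l2norm_ge0//.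
rewrite sqr_l2norm.
have -> : (a + b) ^+ 2 =
    \sum_(i < d) (a + b) * (a^-1 * x 0 i ^+ 2 + b^-1 * y 0 i ^+ 2).
  rewrite -mulr_sumr big_split/= -!mulr_sumr -!sqr_l2norm -/a -/b.
  by field; rewrite !gt_eqF.
apply: ler_sum => i _; rewrite mxE -subr_ge0.
(* convexity of the square, with weights [a / (a + b)] and [b / (a + b)] *)
set u := x 0 i; set v := y 0 i.
have -> : (a + b) * (a^-1 * u ^+ 2 + b^-1 * v ^+ 2) - (u + v) ^+ 2 =
    (b * u - a * v) ^+ 2 / (a * b).
  by field; rewrite !gt_eqF.
by rewrite divr_ge0 ?sqr_ge0// mulr_ge0 ?ltW.
Qed.

Lemma measurable_l2norm {disp : measure_display} {T : measurableType disp}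
    {R : realType} {d : nat} (v : T -> 'rV[R]_d) :
  (forall i, measurable_fun [set: T] (fun t => v t 0 i)) ->
  measurable_fun [set: T] (fun t => l2norm (v t)).
Proof.
move=> mv; rewrite /l2norm; apply: (measurableT_comp (f := Num.sqrt : R -> R)).
by apply: continuous_measurable_fun; exact: sqrt_continuous.
by apply: measurable_sum => i; exact: measurable_funX.
Qed.

(** Open intervals generate the Borel sets of [R], and a coordinate map is continuous, so it pulls
    them back to open sets of vectors. *)
Lemma measurable_coord {disp : measure_display} {T : measurableType disp}
    {R : realType} {d : nat} (v : T -> 'rV[R]_d) (i : 'I_d) :
  random_vector v -> measurable_fun [set: T] (fun t => v t 0 i).
Proof.
move=> mv; apply: (measurability _ (RGenOpens.measurableE R)).
move=> _ [_ [a [b ->] <-]].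
have /continuousP cont := @coord_continuous R 1 d 0 i.
have oA : open ((fun M : 'rV[R]_d => M 0 i) @^-1` `]a, b[%classic).
  by apply: cont; exact: interval_open.
exact: (mv measurableT _ (sub_sigma_algebra oA)).
Qed.

Lemma measurable_fun_sub_sigma_algebra {disp : measure_display}
    {T : measurableType disp} {G : set (set T)} {d' : measure_display}
    {U : measurableType d'} (g : T -> U) :
  sub_sigma_algebra_of G ->
  measurable_fun [set: g_sigma_algebraType G] g -> measurable_fun [set: T] g.
Proof.
move=> [sG Gm] mg _ Y mY; apply: Gm.
by have := mg measurableT Y mY; rewrite /measurable/= sigma_algebra_id.
Qed.

(* The bad event [B = {g < c <= f}] lies in [G], and c P(B) <= E[f; B] <=
   E[g; B], so the integral over [B] of [c - g], which is positive there,
   vanishes. *)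
Lemma ae_lt_of_le_integral {disp : measure_display} {T : measurableType disp}
    {R : realType} (P : probability T R) (G : set (set T)) (f g : T -> \bar R)
    (c : R) :
  sub_sigma_algebra_of G ->
  measurable_fun [set: g_sigma_algebraType G] f ->
  measurable_fun [set: g_sigma_algebraType G] g ->
  (forall t, (0 <= f t)%E) -> (forall t, (0 <= g t)%E) -> 0 <= c ->
  (forall A, G A -> (\int[P]_(t in A) f t <= \int[P]_(t in A) g t)%E) ->
  {ae P, forall t, (g t < c%:E)%E -> (f t < c%:E)%E}.
Proof.
move=> hG mf mg f0 g0 c0 le_fg.
pose B := [set t | (g t < c%:E)%E] `&` [set t | (c%:E <= f t)%E].
have GB : G B.
  have : measurable (B : set (g_sigma_algebraType G)).
    apply: measurableI.
    - rewrite -[X in measurable X]setTI.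
      exact: (emeasurable_fun_infty_o (D := [set: g_sigma_algebraType G])).
    - rewrite -[X in measurable X]setTI.
      exact: (emeasurable_fun_c_infty (D := [set: g_sigma_algebraType G])).
  by rewrite /measurable/= sigma_algebra_id//; case: hG.
have mB : measurable B by case: hG => _; exact.
have mfT : measurable_fun B f.
  by apply: measurable_funTS; exact: (measurable_fun_sub_sigma_algebra _ hG).
have mgT : measurable_fun B g.
  by apply: measurable_funTS; exact: (measurable_fun_sub_sigma_algebra _ hG).
have gfin t : B t -> g t \is a fin_num.
  by move=> [/= gt _]; rewrite ge0_fin_numE// (lt_trans gt)// ltry.
have int_cst : (\int[P]_(t in B) c%:E = c%:E * P B)%E by rewrite -integral_cst.
(* Finite because [g < c] on [B] and [P] is finite; this allows cancelling the integral of [g] in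
   [int_le0]. *)
have int_fin : (\int[P]_(t in B) g t)%E \is a fin_num.
  rewrite ge0_fin_numE ?integral_ge0//.
  apply: (@le_lt_trans _ _ (\int[P]_(t in B) c%:E)%E).
    by apply: ge0_le_integral => // t [/= /ltW].
  by rewrite int_cst -ge0_fin_numE ?mule_ge0// fin_numM// fin_num_measure.
have mh : measurable_fun B (fun t => c%:E - g t)%E.
  by apply: emeasurable_funB => //; exact: measurable_cst.
have h0 t : B t -> (0 <= c%:E - g t)%E.
  by move=> Bt; rewrite sube_ge0 ?gfin//; case: Bt => /= /ltW.
have split_c : (\int[P]_(t in B) c%:E =
    \int[P]_(t in B) g t + \int[P]_(t in B) (c%:E - g t))%E.
  rewrite -ge0_integralD//; apply: eq_integral => t /[!inE] Bt.
  by rewrite addeC subeK ?gfin.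
have int_le0 : (\int[P]_(t in B) (c%:E - g t) <= 0)%E.
  rewrite -(leeD2lE _ _ int_fin) -split_c adde0 (le_trans _ (le_fg _ GB))//.
  by apply: ge0_le_integral => // t [].
have int0 : (\int[P]_(t in B) `|c%:E - g t| = 0)%E.
  rewrite -[RHS](@le_anti _ _ (\int[P]_(t in B) (c%:E - g t))%E 0%E).
    by apply: eq_integral => t /[!inE] Bt; rewrite gee0_abs ?h0.
  by rewrite int_le0 integral_ge0.
have /(ae_eq_integral_abs P mB mh) := int0.
apply: filterS => t ht gt; rewrite ltNge; apply/negP => ft.
have /eqP := ht (conj gt ft).
by rewrite gt_eqF// sube_gt0.
Qed.

(** For finite [y > 0] the step condition reads [a * y < 1 - z]. If [y] is [+oo] the quotient is 0,
    against [0 <= a]; if [y = 0] the product vanishes and [x < z < 1] suffices. *)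
Lemma lte_addM_of_lte_div {R : realType} (z a : R) (x y : \bar R) :
  z < 1 -> (0 <= x)%E -> (0 <= y)%E ->
  (x < z%:E)%E -> (a%:E < (1 - z)%:E / y)%E -> 0 <= a ->
  (x + a%:E * y < 1)%E.
Proof.
move=> z1 x0 y0 xz ay a0.
have xfin : x \is a fin_num by rewrite ge0_fin_numE// (lt_trans xz)// ltry.
rewrite -(fineK xfin) in xz *.
case: y y0 ay => [y| |]// y0; last first.
  by rewrite invey mule0 lte_fin ltNge a0.
have [->|yn0] := eqVneq y 0.
  by rewrite mule0 adde0 => _; rewrite (lt_trans xz).
have {}y0 : 0 < y by rewrite lt_def yn0.
rewrite inver (negbTE yn0) -EFinM lte_fin ltr_pdivlMr// => ay.
rewrite -EFinM -EFinD lte_fin.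
by move: xz; rewrite lte_fin; lra.
Qed.

(* Vectors are rows, so the product of the Jacobian with eta is written
   eta *m 'J p w, where 'J p w is the library's (row-convention) Jacobian.

   E_k is the conditional expectation given the sigma-algebra F k; F is an
   arbitrary family of sub-sigma-algebras, which covers averaging over the
   batches X k, S k given the past (F k generated by what precedes them) as
   well as conditioning on the batches themselves (F k generated by X k, S k).
   Eprop, Exi, Enext are versions of the three conditional expectations, hence
   functions of the outcome t, and the implication holds almost surely.

   Division is that of the extended reals: a / 0 = +oo and a / +oo = 0 for
   a > 0, so the step-length condition is void if Exi k t = 0 and fails if
   Exi k t = +oo. *)
Theorem theorem3p1 (R : realType) (d : nat)
  (disp : measure_display) (T : measurableType disp) (P : probability T R)
  (dX dS : measure_display) (BX : measurableType dX) (BS : measurableType dS)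
  (p : 'rV[R]_d -> 'rV[R]_d)
  (hp : forall x : 'rV[R]_d, differentiable p x)
  (dt : R) (hdt : 0 < dt)
  (w : nat -> 'rV[R]_d)
  (hw : forall k, w k.+1 = w k + dt *: p (w k))
  (pMC : 'rV[R]_d -> BX -> BS -> 'rV[R]_d)
  (hpMC : measurable_direction pMC)
  (X : nat -> {RV P >-> BX}) (S : nat -> {RV P >-> BS})
  (eta : nat -> T -> 'rV[R]_d)
  (heta_meas : forall k, random_vector (eta k))
  (heta : forall k t,
     eta k.+1 t = eta k t + dt *: (eta k t *m 'J p (w k))
                  + dt *: xiMC p pMC (w k + eta k t) (X k t) (S k t))
  (F : nat -> set (set T))
  (hF : forall k, sub_sigma_algebra_of (F k))
  (Eprop Exi Enext : nat -> T -> \bar R)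
  (hEprop : forall k, is_cond_exp P (F k)
     (fun t => (l2norm (eta k t *m (1%:M + dt *: 'J p (w k))))%:E) (Eprop k))
  (hExi : forall k, is_cond_exp P (F k)
     (fun t => (l2norm (xiMC p pMC (w k + eta k t) (X k t) (S k t)))%:E)
     (Exi k))
  (hEnext : forall k, is_cond_exp P (F k)
     (fun t => (l2norm (eta k.+1 t))%:E) (Enext k))
  (zeta : R) (hzeta : 0 < zeta < 1) (k : nat) :
  {ae P, forall t,
     (Eprop k t < zeta%:E)%E ->
     (dt%:E < (1 - zeta)%:E / Exi k t)%E ->
     (Enext k t < 1)%E}.
Proof.
pose A := 1%:M + dt *: 'J p (w k).
pose xi t := xiMC p pMC (w k + eta k t) (X k t) (S k t).
have [mEprop Eprop0 intEprop] := hEprop k.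
have [mExi Exi0 intExi] := hExi k.
have [mEnext Enext0 intEnext] := hEnext k.
have dt0 := ltW hdt.
have etaS t : eta k.+1 t = eta k t *m A + dt *: xi t.
  by rewrite heta /A mulmxDr mulmx1 -scalemxAr.
have meta j i : measurable_fun [set: T] (fun t => eta j t 0 i).
  exact: measurable_coord.
have mprop i : measurable_fun [set: T] (fun t => (eta k t *m A) 0 i).
  under eq_fun do rewrite mxE.
  by apply: measurable_sum => j; apply: measurable_funM.
have xiE t : xi t = dt^-1 *: (eta k.+1 t - eta k t *m A).
  by rewrite etaS addrC addKr scalerA mulVf ?gt_eqF// scale1r.
have mxi i : measurable_fun [set: T] (fun t => xi t 0 i).
  under eq_fun do rewrite xiE mxE [X in _ * X]mxE [X in _ + X]mxE.
  by apply: measurable_funM => //; apply: measurable_funB.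
have mn (v : T -> 'rV[R]_d) :
    (forall i, measurable_fun [set: T] (fun t => v t 0 i)) ->
    forall B, measurable_fun B (fun t => (l2norm (v t))%:E).
  move=> mv B; apply: measurable_funTS; apply/measurable_EFinP.
  exact: measurable_l2norm.
pose bound t := (Eprop k t + dt%:E * Exi k t)%E.
(* Measurability is needed for [F k] itself, so that the event where the comparison fails belongs to
   [F k]. *)
have mbound : measurable_fun [set: g_sigma_algebraType (F k)] bound.
  apply: emeasurable_funD => //; exact: measurable_funeM.
have bound0 t : (0 <= bound t)%E.
  by rewrite adde_ge0// mule_ge0// lee_fin.
(* On events of [F k] each version has the same integral as its norm. Linearity splits the bound,
   the norms replace the versions, and the reassembled sum is compared pointwise. *)
have le_bound B : F k B ->
    (\int[P]_(t in B) Enext k t <= \int[P]_(t in B) bound t)%E.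
  move=> FB; have mB : measurable B by case: (hF k) => _; exact.
  have mT g : measurable_fun [set: g_sigma_algebraType (F k)] g ->
      measurable_fun B (g : T -> \bar R).
    move=> mg; apply: measurable_funTS.
    exact: (measurable_fun_sub_sigma_algebra _ (hF k)).
  rewrite intEnext// ge0_integralD//; [|exact: mT| |]; last 2 first.
  - by move=> t _; rewrite mule_ge0// lee_fin.
  - by apply: measurable_funeM; exact: mT.
  rewrite ge0_integralZl//; [|exact: mT].
  rewrite intEprop// intExi// -ge0_integralZl//; last 2 first.
  - exact: mn.
  - by move=> t _; rewrite lee_fin l2norm_ge0.
  rewrite -ge0_integralD//; [| | | |]; last first.
  - by apply: measurable_funeM; exact: mn.
  - by move=> t _; rewrite mule_ge0// lee_fin ?l2norm_ge0.
  - exact: mn.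
  - by move=> t _; rewrite lee_fin l2norm_ge0.
  apply: ge0_le_integral => //.
  - by move=> t _; rewrite lee_fin l2norm_ge0.
  - exact: mn.
  - apply: emeasurable_funD; first exact: mn.
    by apply: measurable_funeM; exact: mn.
  - move=> t _; rewrite -EFinM -EFinD lee_fin -l2normZ// etaS.
    exact: ler_l2normD.
have := ae_lt_of_le_integral P (F k) (Enext k) bound 1 (hF k) mEnext mbound
  Enext0 bound0 ler01 le_bound.
apply: filterS => t bound_lt1 hprop hstep; apply: bound_lt1.
by case/andP: hzeta => _ zeta1; exact: lte_addM_of_lte_div hprop hstep _.
Qed.
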